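(* Let $1\le n\le p$ be integers, let $\bm X\in\mathbb R^{n\times p}$, let $q\in(0,1)$, $\tau_1^2>\tau_0^2>0$, $a_0,b_0>0$, and let $\bm y\in\mathbb R^n$ (linear regression) or $\bm y\in\{0,1\}^n$ (logistic and probit regression). Consider the three Gibbs samplers described in the context: the linear regression sampler (Algorithm L), the probit regression sampler (Algorithm P) and the logistic regression sampler (Algorithm G). For an iteration $t$, let $\bm z_{t-1},\bm z_t\in\{0,1\}^p$ be the spike-and-slab states of the chain at iterations $t-1$ and $t$, and set $$\delta_t=\|\bm z_t-\bm z_{t-1}\|_1,\qquad p_t=\min\{\|\bm z_t\|_1,\;p-\|\bm z_t\|_1,\;\delta_t\}.$$ Then: (i) Algorithm L and Algorithm P both have a computational cost of $\mathcal O\big(\max\{n^2p_t,\,np\}\big)$ at iteration $t$. (ii) Algorithm G has a computational cost of $\mathcal O\big(\max\{n^2p_t,\,n^3,\,np\}\big)$ at iteration $t$. The implied constants are absolute (in particular they do not depend on $n,p,t$, the data, the hyperparameters or the states).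
   Context: **Cost model.** Cost is the number of elementary operations: each scalar arithmetic operation, comparison, memory access, elementary-function evaluation and draw from a univariate distribution (normal, truncated normal, Bernoulli, inverse gamma) costs $\mathcal O(1)$. Matrix operations are the standard ones: multiplying an $a\times b$ by a $b\times c$ matrix costs $\mathcal O(abc)$, inverting a $k\times k$ matrix costs $\mathcal O(k^3)$, and multiplication by a diagonal matrix costs one operation per entry. ''Cost at iteration $t$'' is the cost of producing the output of iteration $t$ from its input. The matrices $\tilde{\bm M}_{\tau_0}=\bm I_n+\tau_0^2\bm X\bm X^\top$, $\tilde{\bm M}_{\tau_1}=\bm I_n+\tau_1^2\bm X\bm X^\top$ and their inverses are computed once before the chain starts, are available at every iteration, and their cost is not counted. **Notation.** $\bm X$ has rows $\bm x_i^\top$ and columns $\bm X_j$. For an index set $S\subseteq\{1,\dots,p\}$, $\bm X_S$ is the $n\times|S|$ submatrix of columns with index in $S$. $\bm D_t$ is the $p\times p$ diagonal matrix with $j$-th diagonal entry $z_{j,t}\tau_1^{-2}+(1-z_{j,t})\tau_0^{-2}$. $A_t=\{j:z_{j,t}=1\}$, $A_t^c=\{j:z_{j,t}=0\}$, $\Delta_t=\{j:z_{j,t}\ne z_{j,t-1}\}$, so $|\Delta_t|=\delta_t$. $\bm C_{\Delta_t}$ is the $\delta_t\times\delta_t$ diagonal matrix with entries $(\bm D_t^{-1})_{jj}-(\bm D_{t-1}^{-1})_{jj}$, $j\in\Delta_t$. $\mathcal N(x;\mu,v)$ is the density at $x$ of the normal law with mean $\mu$ and variance $v$. **Update U (used in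 Algorithms L and P, where $\bm M_t=\bm I_n+\bm X\bm D_t^{-1}\bm X^\top$).** Inputs: $\bm z_t,\bm z_{t-1},\bm M_{t-1},\bm M_{t-1}^{-1}$. Compute $p_t$. Compute $\bm M_t$ by the one of the three expressions $$\bm M_t=\tilde{\bm M}_{\tau_0}+(\tau_1^2-\tau_0^2)\bm X_{A_t}\bm X_{A_t}^\top=\tilde{\bm M}_{\tau_1}+(\tau_0^2-\tau_1^2)\bm X_{A_t^c}\bm X_{A_t^c}^\top=\bm M_{t-1}+\bm X_{\Delta_t}\bm C_{\Delta_t}\bm X_{\Delta_t}^\top$$ whose index set ($A_t$, $A_t^c$ or $\Delta_t$) is smallest, i.e. has size $p_t$. If $p_t\ge n$, invert $\bm M_t$ directly. If $p_t<n$, compute $\bm M_t^{-1}$ by the corresponding one of the Woodbury formulas $$\bm M_t^{-1}=\tilde{\bm M}_{\tau_0}^{-1}-\tilde{\bm M}_{\tau_0}^{-1}\bm X_{A_t}\big((\tau_1^2-\tau_0^2)^{-1}\bm I+\bm X_{A_t}^\top\tilde{\bm M}_{\tau_0}^{-1}\bm X_{A_t}\big)^{-1}\bm X_{A_t}^\top\tilde{\bm M}_{\tau_0}^{-1},$$ $$\bm M_t^{-1}=\tilde{\bm M}_{\tau_1}^{-1}-\tilde{\bm M}_{\tau_1}^{-1}\bm X_{A_t^c}\big((\tau_0^2-\tau_1^2)^{-1}\bm I+\bm X_{A_t^c}^\top\tilde{\bm M}_{\tau_1}^{-1}\bm X_{A_t^c}\big)^{-1}\bm X_{A_t^c}^\top\tilde{\bm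 M}_{\tau_1}^{-1},$$ $$\bm M_t^{-1}=\bm M_{t-1}^{-1}-\bm M_{t-1}^{-1}\bm X_{\Delta_t}\big(\bm C_{\Delta_t}^{-1}+\bm X_{\Delta_t}^\top\bm M_{t-1}^{-1}\bm X_{\Delta_t}\big)^{-1}\bm X_{\Delta_t}^\top\bm M_{t-1}^{-1}.$$ **Gaussian step.** Given a diagonal positive $n\times n$ matrix $\bm W$, a vector $\bm w\in\mathbb R^n$, a scalar $s>0$ and $\bm M_t^{-1}$ where $\bm M_t=\bm I_n+\bm W^{-1/2}\bm X\bm D_t^{-1}\bm X^\top\bm W^{-1/2}$: draw $\bm r\sim\mathcal N(0,\bm I_p)$, $\bm\xi\sim\mathcal N(0,\bm I_n)$; set $\bm u=\bm D_t^{-1/2}\bm r$, $\bm v=\bm W^{-1/2}\bm X\bm u+\bm\xi$, $\bm v^*=\bm M_t^{-1}(\tfrac1s\bm W^{-1/2}\bm w-\bm v)$; return $\bm\beta=s(\bm u+\bm D_t^{-1}\bm X^\top\bm W^{-1/2}\bm v^* )$. **Algorithm L (linear), iteration $t$.** Input $(\bm\beta_t,\bm z_t,\sigma_t^2)\in\mathbb R^p\times\{0,1\}^p\times(0,\infty)$, $\bm z_{t-1}$, $\bm M_{t-1}$, $\bm M_{t-1}^{-1}$. 1. Compute $\bm M_t,\bm M_t^{-1}$ by Update U. 2. $\bm\beta_{t+1}$: Gaussian step with $\bm W=\bm I_n$, $\bm w=\bm y$, $s=\sigma_t$. 3. For $j=1,\dots,p$ independently, $z_{j,t+1}\sim\mathrm{Bernoulli}\Big(\frac{q\mathcal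 N(\beta_{j,t+1};0,\sigma_t^2\tau_1^2)}{q\mathcal N(\beta_{j,t+1};0,\sigma_t^2\tau_1^2)+(1-q)\mathcal N(\beta_{j,t+1};0,\sigma_t^2\tau_0^2)}\Big)$. 4. $\sigma_{t+1}^2\sim\mathrm{InvGamma}\Big(\frac{a_0+n+p}{2},\frac{b_0+\|\bm y-\bm X\bm\beta_{t+1}\|_2^2+\bm\beta_{t+1}^\top\bm D_{t+1}\bm\beta_{t+1}}{2}\Big)$. Output $(\bm\beta_{t+1},\bm z_{t+1},\sigma_{t+1}^2)$, $\bm z_t$, $\bm M_t$, $\bm M_t^{-1}$. **Algorithms P (probit) and G (logistic), iteration $t$.** Input $(\bm\beta_t,\bm z_t,\tilde{\bm y}_t,\tilde{\bm\sigma}_t^2)\in\mathbb R^p\times\{0,1\}^p\times\mathbb R^n\times(0,\infty)^n$, $\bm z_{t-1}$, $\tilde{\bm\sigma}_{t-1}^2$, $\bm M_{t-1}$, $\bm M_{t-1}^{-1}$. Write $\bm W_t=\mathrm{Diag}(\tilde{\bm\sigma}_t^2)$ and $\bm M_t=\bm I_n+\bm W_t^{-1/2}\bm X\bm D_t^{-1}\bm X^\top\bm W_t^{-1/2}$; for probit all $\tilde\sigma_{i,t}^2=1$. 1. Probit: compute $\bm M_t,\bm M_t^{-1}$ by Update U. Logistic: compute $\bm M_t=\bm I_n+\bm W_t^{-1/2}\bm B_t\bm W_t^{-1/2}$, where $\bm B_t=\bm X\bm D_t^{-1}\bm X^\top$ is computed by the one of the expressions $$\tilde{\bm M}_{\tau_0}-\bm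 I_n+(\tau_1^2-\tau_0^2)\bm X_{A_t}\bm X_{A_t}^\top,\quad \tilde{\bm M}_{\tau_1}-\bm I_n+(\tau_0^2-\tau_1^2)\bm X_{A_t^c}\bm X_{A_t^c}^\top,\quad \bm W_{t-1}^{1/2}(\bm M_{t-1}-\bm I_n)\bm W_{t-1}^{1/2}+\bm X_{\Delta_t}\bm C_{\Delta_t}\bm X_{\Delta_t}^\top$$ with smallest index set; then invert $\bm M_t$ directly. 2. $\bm\beta_{t+1}$: Gaussian step with $\bm W=\bm W_t$, $\bm w=\tilde{\bm y}_t$, $s=1$. 3. For $j=1,\dots,p$ independently, $z_{j,t+1}\sim\mathrm{Bernoulli}\Big(\frac{q\mathcal N(\beta_{j,t+1};0,\tau_1^2)}{q\mathcal N(\beta_{j,t+1};0,\tau_1^2)+(1-q)\mathcal N(\beta_{j,t+1};0,\tau_0^2)}\Big)$. 4. For $i=1,\dots,n$ independently, $\tilde y_{i,t+1}$ is drawn from $\mathcal N(\bm x_i^\top\bm\beta_{t+1},\tilde\sigma_{i,t}^2)$ truncated to $[0,\infty)$ if $y_i=1$ and to $(-\infty,0)$ if $y_i=0$. 5. Logistic: for $i=1,\dots,n$ independently, $\tilde\sigma_{i,t+1}^2\sim\mathrm{InvGamma}\Big(\frac{\nu+1}{2},\frac{w^2\nu+(\tilde y_{i,t+1}-\bm x_i^\top\bm\beta_{t+1})^2}{2}\Big)$ with $\nu=7.3$, $w^2=\pi^2(\nu-2)/(3\nu)$. Probit: $\tilde\sigma_{i,t+1}^2=1$ for all $i$. Output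 $(\bm\beta_{t+1},\bm z_{t+1},\tilde{\bm y}_{t+1},\tilde{\bm\sigma}_{t+1}^2)$, $\bm z_t$, $\tilde{\bm\sigma}_t^2$, $\bm M_t$, $\bm M_t^{-1}$. *)

(* Defs.v *)
From mathcomp Require Import all_boot all_order all_algebra.
From mathcomp Require Import all_classical all_reals all_analysis.

Set Implicit Arguments.
Unset Strict Implicit.
Unset Printing Implicit Defensive.

Import Order.TTheory GRing.Theory Num.Theory.
Import numFieldNormedType.Exports.

Local Open Scope ring_scope.

Section Language.
Variable R : realType.

(* Scalar expressions.  Every node is one elementary operation: a leaf is a
   memory access, an inner node an arithmetic operation, a comparison or an
   elementary function.  Leaves are only meant to hold stored numbers and
   constants; anything that has to be computed must be spelled out. *)
Inductive expr : Type -> Type :=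
| Rd of R : expr R
| Nat of nat : expr nat
| OfNat of expr nat : expr R
| Add of expr R & expr R : expr R
| Sub of expr R & expr R : expr R
| Mul of expr R & expr R : expr R
| Div of expr R & expr R : expr R
| Sqrt of expr R : expr R
| Exp of expr R : expr R
| MinN of expr nat & expr nat : expr nat
| EqN of expr nat & expr nat : expr bool
| LeN of expr nat & expr nat : expr bool
| Not of expr bool : expr bool.

Fixpoint eval A (e : expr A) : A :=
  match e in expr A return A with
  | Rd x => x
  | Nat k => k
  | OfNat a => (eval a)%:R
  | Add a b => eval a + eval b
  | Sub a b => eval a - eval b
  | Mul a b => eval a * eval b
  | Div a b => eval a / eval b
  | Sqrt a => Num.sqrt (eval a)
  | Exp a => expR (eval a)
  | MinN a b => minn (eval a) (eval b)
  | EqN a b => eval a == eval b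
  | LeN a b => (eval a <= eval b)%N
  | Not a => ~~ eval a
  end.

Fixpoint esize A (e : expr A) : nat :=
  match e with
  | Rd _ | Nat _ => 1
  | OfNat a => (esize a).+1
  | Sqrt a | Exp a => (esize a).+1
  | Not a => (esize a).+1
  | Add a b | Sub a b | Mul a b | Div a b => (esize a + esize b).+1
  | MinN a b | EqN a b | LeN a b => (esize a + esize b).+1
  end.

Inductive law : Type -> Type :=
| Normal (mean variance : R) : law R
| TruncNormal (mean variance : R) (J : interval R) : law R
| Bernoulli (r : R) : law bool
| InvGamma (shape scale : R) : law R.

Definition gamma_fun (a : R) : R :=
  \int[lebesgue_measure]_(x in `]0, +oo[) (x `^ (a - 1) * expR (- x)).

(* Densities: with respect to the counting measure for Bernoulli, to the
   Lebesgue measure otherwise.  The second parameter of [normal_pdf] and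
   [normal_prob] is a standard deviation. *)
Definition density A (l : law A) : A -> R :=
  match l in law A return A -> R with
  | Normal mu v => normal_pdf mu (Num.sqrt v)
  | TruncNormal mu v J => fun x =>
      if x \in J then
        normal_pdf mu (Num.sqrt v) x / fine (normal_prob mu (Num.sqrt v) [set` J])
      else 0
  | Bernoulli r => bernoulli_pmf r
  | InvGamma a b => fun x =>
      if 0 < x then b `^ a / gamma_fun a * x `^ (- a - 1) * expR (- b / x) else 0
  end.

(* [Tab f] fills an array entry by entry, running [f i j] for each entry.
   [Select f] scans the indices and stores those for which [f] answers true,
   together with their number.
   [Any g f] is Dijkstra's guarded alternative: it runs some [f i] whose
   guard [g i] holds, with no commitment as to which one. *)
Inductive prog : Type -> Type :=
| Ret A : A -> prog A
| Bind A B : prog A -> (A -> prog B) -> prog B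
| Eval A : expr A -> prog A
| Draw A : law A -> prog A
| Tab A m n : ('I_m -> 'I_n -> prog A) -> prog 'M[A]_(m, n)
| Select p : ('I_p -> prog bool) -> prog {set 'I_p}
| Any (I : finType) A : (I -> bool) -> (I -> prog A) -> prog A
| MatMul m n k : 'M[R]_(m, n) -> 'M[R]_(n, k) -> prog 'M[R]_(m, k)
| MatInv k : 'M[R]_k -> prog 'M[R]_k.

(* [exec K P x c]: some run of P returns x at cost c.  [K] is the constant
   behind the bounds O(1), O(abc), O(k^3) of the cost model; the actual cost of
   each operation may be anything below its bound.  A draw may return any
   point at which the density is positive.  One operation per array entry
   accounts for storing it. *)
Fixpoint exec (K : nat) A (P : prog A) : A -> nat -> Prop :=
  match P in prog A return A -> nat -> Prop with
  | Ret _ a => fun x c => x = a /\ c = 0%N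
  | Bind _ _ Q f => fun y c => exists x c1 c2,
      [/\ exec K Q x c1, exec K (f x) y c2 & c = (c1 + c2)%N]
  | Eval _ e => fun x c => x = eval e /\ (c <= K * esize e)%N
  | Draw _ l => fun x c => 0 < density l x /\ (c <= K)%N
  | Tab _ m n f => fun M c => exists cf cw : 'I_m -> 'I_n -> nat,
      [/\ forall i j, exec K (f i j) (M i j) (cf i j),
          forall i j, (cw i j <= K)%N
        & c = (\sum_i \sum_j (cf i j + cw i j))%N]
  | Select p f => fun S c => exists cf cw : 'I_p -> nat,
      [/\ forall j, exec K (f j) (j \in S) (cf j),
          forall j, (cw j <= K)%N
        & c = (\sum_j (cf j + cw j))%N]
  | Any _ _ g f => fun x c => exists i, g i /\ exec K (f i) x c
  | MatMul m n k M N => fun Q c => Q = M *m N /\ (c <= K * (m * n * k))%N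
  | MatInv k M => fun Q c => Q = invmx M /\ (c <= K * k ^ 3)%N
  end.

End Language.

Arguments Nat {R}.
Arguments Ret {R A}.

Declare Scope expr_scope.
Delimit Scope expr_scope with expr.
Bind Scope expr_scope with expr.
Notation "a + b" := (Add a b) : expr_scope.
Notation "a - b" := (Sub a b) : expr_scope.
Notation "a * b" := (Mul a b) : expr_scope.
Notation "a / b" := (Div a b) : expr_scope.
Notation num k := (OfNat (Nat k)).

Notation "'let*' x := P 'in' Q" := (Bind P (fun x => Q))
  (at level 200, x name, P at level 200, Q at level 200,
   format "'[v' 'let*'  x  :=  P  'in' '/' Q ']'").
Notation "'let*' ' x := P 'in' Q" := (Bind P (fun x => Q))
  (at level 200, x strict pattern, P at level 200, Q at level 200,
   format "'[v' 'let*'  ' x  :=  P  'in' '/' Q ']'").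

Section Subroutines.
Variable R : realType.

Definition vec A n (f : 'I_n -> prog R A) : prog R 'cV[A]_n :=
  Tab (fun i _ => f i).

Definition mx_tr m n (M : 'M[R]_(m, n)) : prog R 'M[R]_(n, m) :=
  Tab (fun i j => Eval (Rd (M j i))).

Definition mx_add m n (M N : 'M[R]_(m, n)) : prog R 'M[R]_(m, n) :=
  Tab (fun i j => Eval (Rd (M i j) + Rd (N i j))).

Definition mx_sub m n (M N : 'M[R]_(m, n)) : prog R 'M[R]_(m, n) :=
  Tab (fun i j => Eval (Rd (M i j) - Rd (N i j))).

Definition mx_scale m n (a : R) (M : 'M[R]_(m, n)) : prog R 'M[R]_(m, n) :=
  Tab (fun i j => Eval (Rd a * Rd (M i j))).

(* Diagonal matrices are stored as the column of their diagonal entries. *)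
Definition mx_diag n (d : 'cV[R]_n) : prog R 'M[R]_n :=
  Tab (fun i j => let* b := Eval (EqN (Nat i) (Nat j)) in
                  if b then Eval (Rd (d i 0)) else Eval (Rd 0)).

Definition mx_id n : prog R 'M[R]_n :=
  Tab (fun i j : 'I_n => let* b := Eval (EqN (Nat i) (Nat j)) in
                  if b then Eval (Rd 1) else Eval (Rd 0)).

Definition diag_mul m n (d : 'cV[R]_m) (M : 'M[R]_(m, n)) : prog R 'M[R]_(m, n) :=
  Tab (fun i j => Eval (Rd (d i 0) * Rd (M i j))).

Definition mul_diag m n (M : 'M[R]_(m, n)) (d : 'cV[R]_n) : prog R 'M[R]_(m, n) :=
  Tab (fun i j => Eval (Rd (M i j) * Rd (d j 0))).

Definition mx_cols m n (M : 'M[R]_(m, n)) (S : {set 'I_n}) :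
    prog R 'M[R]_(m, #|S|) :=
  Tab (fun i k => Eval (Rd (M i (enum_val k)))).

(* Binv - Binv U (Cinv + U^T Binv U)^-1 U^T Binv *)
Definition woodbury n k (Binv : 'M[R]_n) (U : 'M[R]_(n, k)) (Cinv : 'M[R]_k) :
    prog R 'M[R]_n :=
  let* Ut := mx_tr U in
  let* BU := MatMul Binv U in
  let* UtBU := MatMul Ut BU in
  let* core := mx_add Cinv UtBU in
  let* core_inv := MatInv core in
  let* UtB := MatMul Ut Binv in
  let* L := MatMul BU core_inv in
  let* corr := MatMul L UtB in
  mx_sub Binv corr.

Definition normal_expr (x mu v : expr R R) : expr R R :=
  (Exp ((Rd 0 - (x - mu) * (x - mu)) / (Rd 2 * v)) / Sqrt (Rd 2 * Rd pi * v))%expr.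

End Subroutines.

Section Samplers.
Variables (R : realType) (n p : nat) (X : 'M[R]_(n, p)).
Variables (q tau0sq tau1sq : R).

(* [Mtilde tau0sq], [Mtilde tau1sq] and their inverses are computed once before the
   chain starts, so the programs below use them at no cost. *)
Definition Mtilde (tau : R) : 'M[R]_n := 1%:M + tau *: (X *m X^T).

Definition Dmx (z : 'cV[bool]_p) : 'M[R]_p :=
  diag_mx (\row_j ((z j 0)%:R * tau1sq^-1 + (1 - (z j 0)%:R) * tau0sq^-1)).

Definition Wmx_m12 (w : 'cV[R]_n) : 'M[R]_n :=
  diag_mx (\row_i (Num.sqrt (w i 0))^-1).

Definition Mmx (w : 'cV[R]_n) (z : 'cV[bool]_p) : 'M[R]_n :=
  1%:M + Wmx_m12 w *m X *m invmx (Dmx z) *m X^T *m Wmx_m12 w.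

Definition norm1 (z : 'cV[bool]_p) : nat := (\sum_j z j ord0)%N.

Definition delta (z z' : 'cV[bool]_p) : nat :=
  (\sum_j `|(z j ord0 : nat)%:Z - (z' j ord0 : nat)%:Z|)%N.

Definition p_t (z z' : 'cV[bool]_p) : nat :=
  minn (minn (norm1 z) (p - norm1 z)) (delta z z').

Section Subprograms.
Implicit Types (z : 'cV[bool]_p) (S : {set 'I_p}).

Definition D_expr z (j : 'I_p) : expr R R :=
  (num (z j ord0) * (Rd 1 / Rd tau1sq) + (Rd 1 - num (z j ord0)) * (Rd 1 / Rd tau0sq))%expr.

Definition D_prog z : prog R 'cV[R]_p := vec (fun j => Eval (D_expr z j)).

Definition C_prog z z' S : prog R 'cV[R]_#|S| :=
  vec (fun k => Eval (Rd 1 / D_expr z (enum_val k) - Rd 1 / D_expr z' (enum_val k))).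

Definition active z : prog R {set 'I_p} :=
  Select (fun j => Eval (EqN (Nat (z j ord0)) (Nat 1))).

Definition inactive z : prog R {set 'I_p} :=
  Select (fun j => Eval (EqN (Nat (z j ord0)) (Nat 0))).

Definition flipped z z' : prog R {set 'I_p} :=
  Select (fun j => Eval (Not (EqN (Nat (z j ord0)) (Nat (z' j ord0))))).

(* The three index sets A_t, A_t^c and Delta_t correspond to 0, 1, 2 : 'I_3;
   ties between them may be broken in any way. *)
Definition case3 T (a b c : T) (i : 'I_3) : T :=
  if val i is 0 then a else if val i is 1 then b else c.

Definition smallest T (A Ac Dl : {set 'I_p}) (f : nat -> 'I_3 -> prog R T) :
    prog R T :=
  let* pt := Eval (MinN (MinN (Nat #|A|) (Nat #|Ac|)) (Nat #|Dl|)) in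
  let* gA := Eval (EqN (Nat #|A|) (Nat pt)) in
  let* gAc := Eval (EqN (Nat #|Ac|) (Nat pt)) in
  let* gDl := Eval (EqN (Nat #|Dl|) (Nat pt)) in
  Any (case3 gA gAc gDl) (f pt).

Definition scaled_gram k (a : R) (U : 'M[R]_(n, k)) : prog R 'M[R]_n :=
  let* Ut := mx_tr U in
  let* G := MatMul U Ut in
  mx_scale a G.

Definition diag_gram k (U : 'M[R]_(n, k)) (c : 'cV[R]_k) : prog R 'M[R]_n :=
  let* Ut := mx_tr U in
  let* Uc := mul_diag U c in
  MatMul Uc Ut.

(* base + a X_S X_S^T, with its inverse *)
Definition update_scaled (pt : nat) (base base_inv : 'M[R]_n) (a : R) S :
    prog R ('M[R]_n * 'M[R]_n) :=
  let* U := mx_cols X S in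
  let* G := scaled_gram a U in
  let* M := mx_add base G in
  let* large := Eval (LeN (Nat n) (Nat pt)) in
  let* Minv :=
    (if large then MatInv M else
     let* ainv := Eval (Rd 1 / Rd a) in
     let* I := mx_id R #|S| in
     let* Cinv := mx_scale ainv I in
     woodbury base_inv U Cinv) in
  Ret (M, Minv).

(* base + X_S diag(c) X_S^T, with its inverse *)
Definition update_diag (pt : nat) (base base_inv : 'M[R]_n) S (c : 'cV[R]_#|S|) :
    prog R ('M[R]_n * 'M[R]_n) :=
  let* U := mx_cols X S in
  let* G := diag_gram U c in
  let* M := mx_add base G in
  let* large := Eval (LeN (Nat n) (Nat pt)) in
  let* Minv :=
    (if large then MatInv M else
     let* cinv := vec (fun k => Eval (Rd 1 / Rd (c k 0))) in
     let* Cinv := mx_diag cinv in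
     woodbury base_inv U Cinv) in
  Ret (M, Minv).

Definition updateU z z' (Mprev Mprev_inv : 'M[R]_n) :
    prog R ('M[R]_n * 'M[R]_n) :=
  let* A := active z in
  let* Ac := inactive z in
  let* Dl := flipped z z' in
  smallest A Ac Dl (fun pt => case3
    (let* a := Eval (Rd tau1sq - Rd tau0sq) in
     update_scaled pt (Mtilde tau0sq) (invmx (Mtilde tau0sq)) a A)
    (let* a := Eval (Rd tau0sq - Rd tau1sq) in
     update_scaled pt (Mtilde tau1sq) (invmx (Mtilde tau1sq)) a Ac)
    (let* c := C_prog z z' Dl in
     update_diag pt Mprev Mprev_inv c)).

Definition gaussian_step z (W w : 'cV[R]_n) (s : R) (Minv : 'M[R]_n) :
    prog R 'cV[R]_p :=
  let* r := vec (fun _ => Draw (Normal 0 1)) in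
  let* xi := vec (fun _ => Draw (Normal 0 1)) in
  let* D := D_prog z in
  let* u := vec (fun j => Eval (Rd 1 / Sqrt (Rd (D j 0)) * Rd (r j 0))) in
  let* Wm12 := vec (fun i => Eval (Rd 1 / Sqrt (Rd (W i 0)))) in
  let* Xu := MatMul X u in
  let* v := vec (fun i => Eval (Rd (Wm12 i 0) * Rd (Xu i 0) + Rd (xi i 0))) in
  let* rhs := vec (fun i =>
    Eval (Rd 1 / Rd s * (Rd (Wm12 i 0) * Rd (w i 0)) - Rd (v i 0))) in
  let* vstar := MatMul Minv rhs in
  let* Wv := diag_mul Wm12 vstar in
  let* Xt := mx_tr X in
  let* XtWv := MatMul Xt Wv in
  vec (fun j => Eval (Rd s * (Rd (u j 0) + Rd 1 / Rd (D j 0) * Rd (XtWv j 0)))).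

(* sigma2 is the extra factor in the variances (1 in Algorithms P and G). *)
Definition draw_z (beta : 'cV[R]_p) (sigma2 : expr R R) : prog R 'cV[bool]_p :=
  vec (fun j =>
    let slab := (Rd q * normal_expr (Rd (beta j 0)) (Rd 0) (sigma2 * Rd tau1sq))%expr in
    let spike :=
      ((Rd 1 - Rd q) * normal_expr (Rd (beta j 0)) (Rd 0) (sigma2 * Rd tau0sq))%expr in
    let* r := Eval (slab / (slab + spike)) in
    Draw (Bernoulli r)).

Definition dot k (u v : 'cV[R]_k) : prog R R :=
  let* ut := mx_tr u in
  let* uv := MatMul ut v in
  Eval (Rd (uv 0 0)).

End Subprograms.

(* The state of iteration t together with z_{t-1}, M_{t-1}, M_{t-1}^-1: this is
   both the input of iteration t and, shifted by one, its output. *)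
Record stateL := StateL {
  betaL : 'cV[R]_p;
  zL : 'cV[bool]_p;
  sigma2L : R;
  zprevL : 'cV[bool]_p;
  MprevL : 'M[R]_n;
  MprevL_inv : 'M[R]_n }.

Definition validL (s : stateL) : Prop :=
  [/\ 0 < sigma2L s,
      MprevL s = Mmx (const_mx 1) (zprevL s)
    & MprevL_inv s = invmx (MprevL s)].

Definition algL (a0 b0 : R) (y : 'cV[R]_n) (s : stateL) : prog R stateL :=
  let z := zL s in
  let* '(M, Minv) := updateU z (zprevL s) (MprevL s) (MprevL_inv s) in
  let* W := vec (fun _ => Eval (Rd 1)) in
  let* sigma := Eval (Sqrt (Rd (sigma2L s))) in
  let* beta := gaussian_step z W y sigma Minv in
  let* znew := draw_z beta (Rd (sigma2L s)) in
  let* Xbeta := MatMul X beta in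
  let* res := mx_sub y Xbeta in
  let* rss := dot res res in
  let* Dnew := D_prog znew in
  let* Dbeta := diag_mul Dnew beta in
  let* pen := dot beta Dbeta in
  let* shape := Eval ((Rd a0 + num n + num p) / Rd 2) in
  let* scale := Eval ((Rd b0 + Rd rss + Rd pen) / Rd 2) in
  let* sigma2new := Draw (InvGamma shape scale) in
  Ret (StateL beta znew sigma2new z M Minv).

Record stateB := StateB {
  betaB : 'cV[R]_p;
  zB : 'cV[bool]_p;
  ytilB : 'cV[R]_n;
  sigma2B : 'cV[R]_n;
  zprevB : 'cV[bool]_p;
  sigma2prevB : 'cV[R]_n;
  MprevB : 'M[R]_n;
  MprevB_inv : 'M[R]_n }.

Definition validG (s : stateB) : Prop :=
  [/\ forall i, 0 < sigma2B s i 0,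
      forall i, 0 < sigma2prevB s i 0,
      MprevB s = Mmx (sigma2prevB s) (zprevB s)
    & MprevB_inv s = invmx (MprevB s)].

Definition validP (s : stateB) : Prop :=
  [/\ validG s, sigma2B s = const_mx 1 & sigma2prevB s = const_mx 1].

Definition draw_ytil (y : 'cV[bool]_n) (mu sigma2 : 'cV[R]_n) :
    prog R 'cV[R]_n :=
  vec (fun i =>
    let* pos := Eval (EqN (Nat (y i ord0)) (Nat 1)) in
    let* m := Eval (Rd (mu i 0)) in
    let* v := Eval (Rd (sigma2 i 0)) in
    Draw (TruncNormal m v (if pos then `[0, +oo[ else `]-oo, 0[))).

Definition algP (y : 'cV[bool]_n) (s : stateB) : prog R stateB :=
  let z := zB s in
  let* '(M, Minv) := updateU z (zprevB s) (MprevB s) (MprevB_inv s) in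
  let* beta := gaussian_step z (sigma2B s) (ytilB s) 1 Minv in
  let* znew := draw_z beta (Rd 1) in
  let* Xbeta := MatMul X beta in
  let* ynew := draw_ytil y Xbeta (sigma2B s) in
  let* sigma2new := vec (fun _ => Eval (Rd 1)) in
  Ret (StateB beta znew ynew sigma2new z (sigma2B s) M Minv).

(* Computes B_t = X D_t^-1 X^T. *)
Definition updateB (z zprev : 'cV[bool]_p) (Wprev : 'cV[R]_n) (Mprev : 'M[R]_n) :
    prog R 'M[R]_n :=
  let* A := active z in
  let* Ac := inactive z in
  let* Dl := flipped z zprev in
  let* I := mx_id R n in
  smallest A Ac Dl (fun _ => case3
    (let* base := mx_sub (Mtilde tau0sq) I in
     let* a := Eval (Rd tau1sq - Rd tau0sq) in
     let* U := mx_cols X A in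
     let* G := scaled_gram a U in
     mx_add base G)
    (let* base := mx_sub (Mtilde tau1sq) I in
     let* a := Eval (Rd tau0sq - Rd tau1sq) in
     let* U := mx_cols X Ac in
     let* G := scaled_gram a U in
     mx_add base G)
    (let* M0 := mx_sub Mprev I in
     let* W12 := vec (fun i => Eval (Sqrt (Rd (Wprev i 0)))) in
     let* WM0 := diag_mul W12 M0 in
     let* base := mul_diag WM0 W12 in
     let* c := C_prog z zprev Dl in
     let* U := mx_cols X Dl in
     let* G := diag_gram U c in
     mx_add base G)).

Definition nuG : R := 73 / 10.
Definition w2G : R := pi ^+ 2 * (nuG - 2) / (3 * nuG).

Definition algG (y : 'cV[bool]_n) (s : stateB) : prog R stateB :=
  let z := zB s in
  let* B := updateB z (zprevB s) (sigma2prevB s) (MprevB s) in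
  let* Wm12 := vec (fun i => Eval (Rd 1 / Sqrt (Rd (sigma2B s i 0)))) in
  let* WB := diag_mul Wm12 B in
  let* WBW := mul_diag WB Wm12 in
  let* I := mx_id R n in
  let* M := mx_add I WBW in
  let* Minv := MatInv M in
  let* beta := gaussian_step z (sigma2B s) (ytilB s) 1 Minv in
  let* znew := draw_z beta (Rd 1) in
  let* Xbeta := MatMul X beta in
  let* ynew := draw_ytil y Xbeta (sigma2B s) in
  let* sigma2new := vec (fun i =>
    let e := (Rd (ynew i 0) - Rd (Xbeta i 0))%expr in
    let* shape := Eval ((Rd nuG + Rd 1) / Rd 2) in
    let* scale := Eval ((Rd w2G * Rd nuG + e * e) / Rd 2) in
    Draw (InvGamma shape scale)) in
  Ret (StateB beta znew ynew sigma2new z (sigma2B s) M Minv).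

End Samplers.

(* Main.v *)
(* Every cost in the model is at most K times an explicit polynomial in the
   dimensions, so bounds compose along the program.  The guards of Update U force
   the chosen index set to have exactly p_t elements; the Gram product then
   costs n^2 p_t, the inversion costs n^3 <= n^2 p_t when p_t >= n, and when
   p_t < n each product in the Woodbury formula costs at most n^2 p_t.
   Everything else is O(np), using n^2 <= np, except for the unconditional n^3
   inversion of Algorithm G. *)

Require Import Defs.
From mathcomp Require Import all_boot all_order all_algebra.
From mathcomp Require Import all_classical all_reals all_analysis.
From mathcomp Require Import zify.

Set Implicit Arguments.
Unset Strict Implicit.
Unset Printing Implicit Defensive.

Import Order.TTheory GRing.Theory Num.Theory.

Local Open Scope ring_scope.

(** * Compositional worst-case bounds for the program language *)

Section CostBounds.
Variables (R : realType) (K : nat).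

(** The quantification covers every run, hence every random draw and every resolved choice. The
    factor [K] stays outside, so that [b] is a polynomial in the dimensions with numeral
    coefficients. *)
Definition cost_le A (P : prog R A) (b : nat) : Prop :=
  forall x c, exec K P x c -> (c <= K * b)%N.

Lemma cost_le_weaken A (P : prog R A) b b' :
  cost_le P b -> (b <= b')%N -> cost_le P b'.
Proof.
by move=> hP bb' x c /hP hc; apply: leq_trans hc _; rewrite leq_mul2l bb' orbT.
Qed.

Lemma cost_le_ret A (a : A) : cost_le (Ret a) 0.
Proof. by move=> x c /= [_ ->]. Qed.

(** The continuation is bounded only at values that [P] can return. This lets cardinalities of
    computed sets and values of tests reach the later bounds. *)
Lemma cost_le_bind A B (P : prog R A) (f : A -> prog R B) b1 b2 :
  cost_le P b1 -> (forall x c, exec K P x c -> cost_le (f x) b2) ->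
  cost_le (Bind P f) (b1 + b2).
Proof.
move=> hP hf y c /= [x [c1 [c2 [ex1 ex2 ->]]]].
by rewrite mulnDr leq_add ?(hP _ _ ex1) ?(hf _ _ ex1 _ _ ex2).
Qed.

Lemma cost_le_eval A (e : expr R A) b : esize e = b -> cost_le (Eval e) b.
Proof. by move=> <- x c /= []. Qed.

Lemma cost_le_draw A (l : law R A) : cost_le (Draw l) 1.
Proof. by move=> x c /= []; rewrite muln1. Qed.

Lemma cost_le_tab A m n (f : 'I_m -> 'I_n -> prog R A) b :
  (forall i j, cost_le (f i j) b) -> cost_le (Tab f) (m * n * b.+1).
Proof.
move=> hf M c /= [cf [cw [hcf hcw ->]]].
apply: (@leq_trans (\sum_(i < m) \sum_(j < n) K * b.+1)%N).
  apply: leq_sum => i _; apply: leq_sum => j _.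
  by rewrite mulnS addnC leq_add ?(hf _ _ _ _ (hcf i j)).
by rewrite !big_const_ord !iter_addn_0; lia.
Qed.

Lemma cost_le_select p (f : 'I_p -> prog R bool) b :
  (forall j, cost_le (f j) b) -> cost_le (Select f) (p * b.+1).
Proof.
move=> hf S c /= [cf [cw [hcf hcw ->]]].
apply: (@leq_trans (\sum_(j < p) K * b.+1)%N).
  by apply: leq_sum => j _; rewrite mulnS addnC leq_add ?(hf _ _ _ (hcf j)).
by rewrite big_const_ord iter_addn_0; lia.
Qed.

Lemma cost_le_any (I : finType) A (g : I -> bool) (f : I -> prog R A) b :
  (forall i, g i -> cost_le (f i) b) -> cost_le (Any g f) b.
Proof. by move=> hf x c /= [i [gi]]; apply: hf. Qed.

Lemma cost_le_matmul m n k (M : 'M[R]_(m, n)) (N : 'M[R]_(n, k)) :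
  cost_le (MatMul M N) (m * n * k).
Proof. by move=> x c /= []. Qed.

Lemma cost_le_matinv k (M : 'M[R]_k) : cost_le (MatInv M) (k * k * k).
Proof. by move=> x c /= [_]; rewrite -mulnA. Qed.

(** Adding the two branch bounds, instead of taking their maximum, keeps the bound polynomial and is
    harmless when both have constant size. *)
Lemma cost_le_if (t : bool) A (P Q : prog R A) b1 b2 :
  cost_le P b1 -> cost_le Q b2 -> cost_le (if t then P else Q) (b1 + b2).
Proof.
by case: t => hP hQ; [apply: cost_le_weaken hP _ | apply: cost_le_weaken hQ _];
   rewrite ?leq_addr ?leq_addl.
Qed.

End CostBounds.

(* Matches on the syntactic head so that subroutines are never unfolded. *)
Ltac cost_step :=
  lazymatch goal with
  | |- cost_le _ (Ret _) _ => apply: cost_le_ret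
  | |- cost_le _ (Bind _ _) _ => apply: cost_le_bind; [| move=> ? ? _]
  | |- cost_le _ (Eval ?e) _ =>
      let v := eval lazy in (esize e) in apply: (@cost_le_eval _ _ _ e v (erefl v))
  | |- cost_le _ (Draw _) _ => apply: cost_le_draw
  | |- cost_le _ (Tab _) _ => apply: cost_le_tab => ? ?
  | |- cost_le _ (Select _) _ => apply: cost_le_select => ?
  | |- cost_le _ (MatMul _ _) _ => apply: cost_le_matmul
  | |- cost_le _ (MatInv _) _ => apply: cost_le_matinv
  | |- cost_le _ (if _ then _ else _) _ => apply: cost_le_if
  end.

(** The bound is first an existential variable, filled in along the syntax of the program; what
    remains is its comparison with the target, besides calls to subroutines. *)
Ltac cost := apply: cost_le_weaken; [repeat cost_step |].

(** * Linear algebra and sampling subroutines *)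

Section SubroutineCosts.
Variables (R : realType) (K n p : nat) (X : 'M[R]_(n, p)).
Variables (q tau0sq tau1sq : R).
Hypotheses (n_gt0 : (0 < n)%N) (le_np : (n <= p)%N).

(** This inequality and the next two absorb the lower-order terms [n], [p] and [n * n] into
    [n * p]. *)
Lemma leq_n_np : (n <= n * p)%N.
Proof. by rewrite leq_pmulr // (leq_trans n_gt0). Qed.

Lemma leq_p_np : (p <= n * p)%N.
Proof. by rewrite leq_pmull. Qed.

Lemma leq_nn_np : (n * n <= n * p)%N.
Proof. by rewrite leq_mul2l le_np orbT. Qed.

Lemma cost_gaussian_step z (W w : 'cV[R]_n) s (Minv : 'M[R]_n) :
  cost_le K (gaussian_step X tau0sq tau1sq z W w s Minv) (100 * (n * p)).
Proof.
rewrite /gaussian_step /D_prog /vec /diag_mul /mx_tr; cost.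
by move: leq_n_np leq_p_np leq_nn_np; lia.
Qed.

(** The variance factor is a leaf [Rd sigma2], so that [esize] of the probability formula evaluates
    to a numeral. *)
Lemma cost_draw_z (beta : 'cV[R]_p) (sigma2 : R) :
  cost_le K (draw_z q tau0sq tau1sq beta (Rd sigma2)) (100 * p).
Proof. by rewrite /draw_z /vec; cost; lia. Qed.

Lemma cost_draw_ytil (y : 'cV[bool]_n) (mu sigma2 : 'cV[R]_n) :
  cost_le K (draw_ytil y mu sigma2) (10 * n).
Proof. by rewrite /draw_ytil /vec; cost; lia. Qed.

Lemma cost_D_prog (z : 'cV[bool]_p) : cost_le K (D_prog tau0sq tau1sq z) (16 * p).
Proof. by rewrite /D_prog /vec; cost; lia. Qed.

Lemma cost_dot k (u v : 'cV[R]_k) : cost_le K (dot u v) (3 * k + 1).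
Proof. by rewrite /dot /mx_tr; cost; lia. Qed.

Lemma cost_scaled_gram k (a : R) (U : 'M[R]_(n, k)) :
  cost_le K (scaled_gram a U) (3 * (n * n * k) + 4 * (n * p)).
Proof.
rewrite /scaled_gram /mx_tr /mx_scale; cost.
have : (n * k <= n * n * k)%N by rewrite -mulnA leq_pmull.
by have := leq_nn_np; lia.
Qed.

Lemma cost_diag_gram k (U : 'M[R]_(n, k)) (c : 'cV[R]_k) :
  cost_le K (diag_gram U c) (7 * (n * n * k)).
Proof.
rewrite /diag_gram /mx_tr /mul_diag; cost.
have : (n * k <= n * n * k)%N by rewrite -mulnA leq_pmull.
by lia.
Qed.

Lemma cost_mx_cols (S : {set 'I_p}) :
  cost_le K (mx_cols X S) (2 * (n * n * #|S|)).
Proof.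
rewrite /mx_cols; cost.
have : (n * #|S| <= n * n * #|S|)%N by rewrite -mulnA leq_pmull.
by lia.
Qed.

Lemma cost_woodbury k (Binv : 'M[R]_n) (U : 'M[R]_(n, k)) (Cinv : 'M[R]_k) :
  (k < n)%N -> cost_le K (woodbury Binv U Cinv) (20 * (n * n * k) + 4 * (n * p)).
Proof.
move=> lt_kn; rewrite /woodbury /mx_tr /mx_add /mx_sub; cost.
have h1 : (n * k <= n * n * k)%N by rewrite -mulnA leq_pmull.
(* From [k < n], the products of cost [n * k * k] and the inversion of cost [k * k * k] are
   dominated by [n * n * k]. *)
have h2 : (k * k <= n * k)%N by rewrite leq_mul2r ltnW ?orbT.
have h3 : (n * k * k <= n * n * k)%N by rewrite -!mulnA leq_mul2l h2 orbT.
have h4 : (k * k * k <= n * n * k)%N by rewrite !leq_mul // ltnW.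
by have := leq_nn_np; lia.
Qed.

(** * Updating the matrix together with its inverse *)

Lemma cost_update_scaled pt (base base_inv : 'M[R]_n) a (S : {set 'I_p}) :
  #|S| = pt ->
  cost_le K (update_scaled X pt base base_inv a S)
    (40 * (n * n * pt) + 40 * (n * p)).
Proof.
move=> <-; rewrite /update_scaled.
have mn := leq_nn_np; have mp := leq_p_np; have n1 := leq_n_np.
apply: cost_le_weaken.
  apply: cost_le_bind; first exact: cost_mx_cols.
  move=> U ? _; apply: cost_le_bind; first exact: cost_scaled_gram.
  move=> G ? _; apply: cost_le_bind; first by rewrite /mx_add; repeat cost_step.
  move=> M ? _; apply: cost_le_bind; first by cost_step.
  (* The outcome of the test is replaced by the comparison of [n] with [#|S|], so that each branch
     below has the inequality it needs. *)
  move=> large ? /= [-> _].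
  (* The bound is stated by hand because direct inversion and Woodbury must share it; adding both
     would bring in an [n * n * n] term that is not controlled when [#|S| < n]. *)
  apply: (cost_le_bind (b1 := 30 * (n * n * #|S|) + 20 * (n * p))); last first.
    by move=> *; exact: cost_le_ret.
  case: leqP => [le_n | lt_n].
    apply: cost_le_weaken; first exact: cost_le_matinv.
    have : (n * n * n <= n * n * #|S|)%N by rewrite leq_mul2l le_n orbT.
    by move: (n * n * #|S|)%N => nnS; lia.
  have kk : (#|S| * #|S| <= n * n)%N by apply: leq_mul; exact: ltnW.
  rewrite /mx_id /mx_scale; cost; first exact: cost_woodbury.
  (* Products are generalized to atoms, which leaves a linear problem for [lia]. *)
  move: kk mn mp n1; move: (n * n * #|S|)%N => nnS.
  by move: (n * n)%N (n * p)%N (#|S| * #|S|)%N; lia.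
move: mn mp n1; move: (n * n * #|S|)%N => nnS.
by move: (n * n)%N (n * p)%N; lia.
Qed.

Lemma cost_update_diag pt (base base_inv : 'M[R]_n) (S : {set 'I_p})
    (c : 'cV[R]_#|S|) :
  #|S| = pt ->
  cost_le K (update_diag X pt base base_inv c)
    (40 * (n * n * pt) + 40 * (n * p)).
Proof.
move=> <-; rewrite /update_diag.
have mn := leq_nn_np; have mp := leq_p_np; have n1 := leq_n_np.
apply: cost_le_weaken.
  apply: cost_le_bind; first exact: cost_mx_cols.
  move=> U ? _; apply: cost_le_bind; first exact: cost_diag_gram.
  move=> G ? _; apply: cost_le_bind; first by rewrite /mx_add; repeat cost_step.
  move=> M ? _; apply: cost_le_bind; first by cost_step.
  move=> large ? /= [-> _].
  apply: (cost_le_bind (b1 := 30 * (n * n * #|S|) + 20 * (n * p))); last first.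
    by move=> *; exact: cost_le_ret.
  case: leqP => [le_n | lt_n].
    apply: cost_le_weaken; first exact: cost_le_matinv.
    have : (n * n * n <= n * n * #|S|)%N by rewrite leq_mul2l le_n orbT.
    by move: (n * n * #|S|)%N => nnS; lia.
  have kk : (#|S| * #|S| <= n * n)%N by apply: leq_mul; exact: ltnW.
  rewrite /mx_diag /vec; cost; first exact: cost_woodbury.
  move: kk mn mp n1; move: (n * n * #|S|)%N => nnS.
  by move: (n * n)%N (n * p)%N (#|S| * #|S|)%N; lia.
move: mn mp n1; move: (n * n * #|S|)%N => nnS.
by move: (n * n)%N (n * p)%N; lia.
Qed.

Lemma cost_C_prog z z' (S : {set 'I_p}) :
  cost_le K (C_prog tau0sq tau1sq z z' S) (40 * p).
Proof.
have le_Sp : (#|S| <= p)%N by rewrite -[leqRHS]card_ord max_card.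
by rewrite /C_prog /vec; cost; move: #|S| le_Sp; lia.
Qed.

(** * Index sets: scanning cost, cardinalities and choice of the smallest *)

Lemma cost_active z : cost_le K (@active R p z) (4 * p).
Proof. by rewrite /active; cost; lia. Qed.

Lemma cost_inactive z : cost_le K (@inactive R p z) (4 * p).
Proof. by rewrite /inactive; cost; lia. Qed.

Lemma cost_flipped z z' : cost_le K (@flipped R p z z') (5 * p).
Proof. by rewrite /flipped; cost; lia. Qed.

Lemma card_active z A c : exec K (@active R p z) A c -> #|A| = norm1 z.
Proof.
move=> /= [cf [cw [hA _ _]]]; rewrite -sum1_card big_mkcond; apply: eq_bigr => j _.
by case: (hA j) => -> _; case: (z j ord0).
Qed.

Lemma card_inactive z A c : exec K (@inactive R p z) A c -> #|A| = (p - norm1 z)%N.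
Proof.
move=> /= [cf [cw [hA _ _]]].
(* The additive form avoids truncated subtraction: at each index exactly one of the two indicators
   equals 1. *)
suff def_p : (#|A| + norm1 z = p)%N by rewrite -[X in (X - _)%N]def_p addnK.
rewrite -sum1_card big_mkcond -big_split /= -[RHS]card_ord -sum1_card.
by apply: eq_bigr => j _; case: (hA j) => -> _; case: (z j ord0).
Qed.

Lemma card_flipped z z' A c : exec K (@flipped R p z z') A c -> #|A| = delta z z'.
Proof.
move=> /= [cf [cw [hA _ _]]]; rewrite -sum1_card big_mkcond; apply: eq_bigr => j _.
by case: (hA j) => -> _; case: (z j ord0); case: (z' j ord0).
Qed.

(** A branch can run only if its guard holds, so a bound is needed only where the chosen set attains
    the minimum. The 14 is the total size of the four scalar tests. *)
Lemma cost_smallest T (A Ac Dl : {set 'I_p}) (f : nat -> 'I_3 -> prog R T) b :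
  (forall i, #|case3 A Ac Dl i| = minn (minn #|A| #|Ac|) #|Dl| ->
     cost_le K (f (minn (minn #|A| #|Ac|) #|Dl|) i) b) ->
  cost_le K (Defs.smallest A Ac Dl f) (14 + b).
Proof.
move=> hf; rewrite /Defs.smallest; apply: cost_le_weaken.
  apply: cost_le_bind; first by cost_step.
  move=> pt ? /= [-> _]; apply: cost_le_bind; first by cost_step.
  move=> ? ? /= [-> _]; apply: cost_le_bind; first by cost_step.
  move=> ? ? /= [-> _]; apply: cost_le_bind; first by cost_step.
  move=> ? ? /= [-> _]; apply: cost_le_any => i gi; apply: hf.
  by move: gi; rewrite /case3; case: (val i) => [|[|?]] /eqP.
by lia.
Qed.

(** * The matrix computation that opens each iteration *)

Lemma cost_updateU z z' (Mprev Mprev_inv : 'M[R]_n) :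
  cost_le K (updateU X tau0sq tau1sq z z' Mprev Mprev_inv)
    (40 * (n * n * p_t z z') + 150 * (n * p)).
Proof.
have mp := leq_p_np; rewrite /updateU; apply: cost_le_weaken.
  apply: cost_le_bind; first exact: cost_active.
  move=> A ? /card_active cA; apply: cost_le_bind; first exact: cost_inactive.
  move=> Ac ? /card_inactive cAc; apply: cost_le_bind; first exact: cost_flipped.
  move=> Dl ? /card_flipped cDl.
  apply: (cost_smallest (b := 40 * (n * n * p_t z z') + 120 * (n * p))) => i.
  (* The sets returned by the scans have the cardinalities that define [p_t], so the chosen set has
     size exactly [p_t z z']. *)
  have -> : minn (minn #|A| #|Ac|) #|Dl| = p_t z z' by rewrite cA cAc cDl.
  rewrite /case3; case: (val i) => [|[|?]] cS.
  - cost; first exact: cost_update_scaled.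
    by move: (n * n * p_t z z')%N => nnpt; lia.
  - cost; first exact: cost_update_scaled.
    by move: (n * n * p_t z z')%N => nnpt; lia.
  - cost; [exact: cost_C_prog | exact: cost_update_diag |].
    by move: (n * n * p_t z z')%N => nnpt; lia.
by move: (n * n * p_t z z')%N => nnpt; lia.
Qed.

Lemma cost_updateB z z' (Wprev : 'cV[R]_n) (Mprev : 'M[R]_n) :
  cost_le K (updateB X tau0sq tau1sq z z' Wprev Mprev)
    (20 * (n * n * p_t z z') + 150 * (n * p)).
Proof.
have mp := leq_p_np; have n1 := leq_n_np; have mn := leq_nn_np.
rewrite /updateB; apply: cost_le_weaken.
  apply: cost_le_bind; first exact: cost_active.
  move=> A ? /card_active cA; apply: cost_le_bind; first exact: cost_inactive.
  move=> Ac ? /card_inactive cAc; apply: cost_le_bind; first exact: cost_flipped.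
  move=> Dl ? /card_flipped cDl.
  apply: cost_le_bind; first by rewrite /mx_id; repeat cost_step.
  move=> I ? _.
  apply: (cost_smallest (b := 20 * (n * n * p_t z z') + 100 * (n * p))) => i.
  have -> : minn (minn #|A| #|Ac|) #|Dl| = p_t z z' by rewrite cA cAc cDl.
  rewrite /case3 /mx_sub /mx_add /vec /diag_mul /mul_diag.
  case: (val i) => [|[|?]] cS.
  - cost; [exact: cost_mx_cols | exact: cost_scaled_gram |].
    by rewrite cS; move: (n * n * p_t z z')%N => nnpt; lia.
  - cost; [exact: cost_mx_cols | exact: cost_scaled_gram |].
    by rewrite cS; move: (n * n * p_t z z')%N => nnpt; lia.
  - cost; [exact: cost_C_prog | exact: cost_mx_cols | exact: cost_diag_gram |].
    by rewrite cS; move: (n * n * p_t z z')%N => nnpt; lia.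
by move: (n * n * p_t z z')%N => nnpt; lia.
Qed.

(** * One full iteration of each sampler *)

Lemma cost_algL a0 b0 (y : 'cV[R]_n) (s : stateL R n p) :
  cost_le K (algL X q tau0sq tau1sq a0 b0 y s)
    (1000 * maxn (n ^ 2 * p_t (zL s) (zprevL s)) (n * p)).
Proof.
have mp := leq_p_np; have n1 := leq_n_np.
rewrite /algL /vec /diag_mul /mx_sub; apply: cost_le_weaken.
  apply: cost_le_bind; first exact: cost_updateU.
  (* Destructing the pair exposes the rest of the program to [cost]. The alternative [leqnn] sets
     the still undetermined bound of this continuation to the sum just computed. *)
  move=> [M Minv] ? _; cost; first [exact: cost_gaussian_step
    | exact: cost_draw_z | exact: cost_dot | exact: cost_D_prog | exact: leqnn].
by rewrite mulnn; lia.
Qed.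

Lemma cost_algP (y : 'cV[bool]_n) (s : stateB R n p) :
  cost_le K (algP X q tau0sq tau1sq y s)
    (1000 * maxn (n ^ 2 * p_t (zB s) (zprevB s)) (n * p)).
Proof.
have mp := leq_p_np; have n1 := leq_n_np.
rewrite /algP /vec; apply: cost_le_weaken.
  apply: cost_le_bind; first exact: cost_updateU.
  move=> [M Minv] ? _; cost; first [exact: cost_gaussian_step
    | exact: cost_draw_z | exact: cost_draw_ytil | exact: leqnn].
by rewrite mulnn; lia.
Qed.

Lemma cost_algG (y : 'cV[bool]_n) (s : stateB R n p) :
  cost_le K (algG X q tau0sq tau1sq y s)
    (1000 * maxn (maxn (n ^ 2 * p_t (zB s) (zprevB s)) (n ^ 3)) (n * p)).
Proof.
have mp := leq_p_np; have n1 := leq_n_np; have mn := leq_nn_np.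
rewrite /algG /vec /diag_mul /mul_diag /mx_add /mx_id; cost;
  first [exact: cost_updateB | exact: cost_gaussian_step
    | exact: cost_draw_z | exact: cost_draw_ytil | idtac].
(* Powers become products, matching the form of the collected bounds; the [n * n * n] term comes
   from the unconditional inversion. *)
by rewrite -mulnn (_ : (n ^ 3 = n * n * n)%N) -?mulnA //; lia.
Qed.

End SubroutineCosts.

Theorem proposition2p1 (K : nat) :
  exists C : nat,
    forall (R : realType) (n p : nat) (X : 'M[R]_(n, p)) (q tau0sq tau1sq a0 b0 : R),
      (1 <= n)%N -> (n <= p)%N ->
      0 < q < 1 -> 0 < tau0sq -> tau0sq < tau1sq -> 0 < a0 -> 0 < b0 ->
      [/\ forall (y : 'cV[R]_n) (s s' : stateL R n p) (cost : nat),
            validL X tau0sq tau1sq s ->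
            exec K (algL X q tau0sq tau1sq a0 b0 y s) s' cost ->
            (cost <= C * maxn (n ^ 2 * p_t (zL s) (zprevL s)) (n * p))%N,
          forall (y : 'cV[bool]_n) (s s' : stateB R n p) (cost : nat),
            validP X tau0sq tau1sq s ->
            exec K (algP X q tau0sq tau1sq y s) s' cost ->
            (cost <= C * maxn (n ^ 2 * p_t (zB s) (zprevB s)) (n * p))%N
        & forall (y : 'cV[bool]_n) (s s' : stateB R n p) (cost : nat),
            validG X tau0sq tau1sq s ->
            exec K (algG X q tau0sq tau1sq y s) s' cost ->
            (cost <= C * maxn (maxn (n ^ 2 * p_t (zB s) (zprevB s)) (n ^ 3)) (n * p))%N].
Proof.
(* The factor 1000 is common to the three iteration bounds. The witness depends on [K] alone, being
   chosen before the dimensions, data and states. *)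
exists (K * 1000)%N => R n p X q tau0sq tau1sq a0 b0 n_gt0 le_np _ _ _ _ _.
split=> y s s' cost _ run; rewrite -mulnA.
- exact: cost_algL run.
- exact: cost_algP run.
- exact: cost_algG run.
Qed.
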